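(* Let $P\subset\mathbb{Z}^n$ be a polymatroid of level $d$, and let $$T_P(x,y):=\frac{(x+y-xy)^n}{x^{n-d}y^d}\;\mathscr{T}_P\!\left(\frac{x}{x+y-xy},\frac{y}{x+y-xy}\right).$$ Then $T_P(x,y)$ is a Laurent polynomial in $x,y$. Moreover, let $\ell$ denote the minimal $y$-degree of $T_P(x,y)$ and let $$B(x,y)=\sum_{i,j\ge 0}\binom{i}{j}x^iy^j=\sum_{i\ge0}x^i(1+y)^i=\frac{1}{1-x(1+y)}.$$ Then for all integers $q\ge-\ell$ one has $$[x^py^q]\,B(x,y)\,T_P(x,-1/y)=0\quad\text{for all integers } p<n+q,$$ and $$[x^{n+q}y^q]\,B(x,y)\,T_P(x,-1/y)=(-1)^{n-d}.$$
   Context: Notation: $[n]=\{1,\dots,n\}$, $n\ge1$; $\mathbf e_1,\dots,\mathbf e_n$ is the canonical basis of $\mathbb{R}^n$; $[x^py^q]F$ is the coefficient of $x^py^q$ in $F$. The product $B(x,y)\,T_P(x,-1/y)$ is a formal series in $x$ (with finitely many negative powers of $x$) whose coefficients are Laurent polynomials in $y$. A polymatroid in $\mathbb{Z}^n$ is a finite nonempty set $P\subset\mathbb{Z}^n$ satisfying the Exchange Axiom: for any $\mathbf a,\mathbf b\in P$ and any $i\in[n]$ with $a_i>b_i$, there exists $j\in[n]$ such that $a_j<b_j$ and both $\mathbf a-\mathbf e_i+\mathbf e_j$ and $\mathbf b+\mathbf e_i-\mathbf e_j$ belong to $P$. The sum $a_1+\dots+a_n$ is the same for all $\mathbf a\in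 P$; this integer is the level of $P$. For $\mathbf a\in P$, an index $i\in[n]$ is internally active if there is no $j<i$ with $\mathbf a-\mathbf e_i+\mathbf e_j\in P$, and externally active if there is no $j<i$ with $\mathbf a+\mathbf e_i-\mathbf e_j\in P$. Let $\mathrm{Int}(\mathbf a),\mathrm{Ext}(\mathbf a)\subseteq[n]$ be the sets of internally, respectively externally, active indices. The polymatroid Tutte polynomial is $$\mathscr{T}_P(x,y)=\sum_{\mathbf a\in P}x^{|\mathrm{Int}(\mathbf a)\setminus\mathrm{Ext}(\mathbf a)|}\,y^{|\mathrm{Ext}(\mathbf a)\setminus\mathrm{Int}(\mathbf a)|}\,(x+y-1)^{|\mathrm{Int}(\mathbf a)\cap\mathrm{Ext}(\mathbf a)|}.$$ *)

(* Defs.v *)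
From HB Require Import structures.
From mathcomp Require Import all_boot all_order all_algebra.
From mathcomp Require Import finmap.

Set Implicit Arguments.
Unset Strict Implicit.
Unset Printing Implicit Defensive.

Import Order.TTheory GRing.Theory Num.Theory.
Local Open Scope fset_scope.
Local Open Scope ring_scope.

Section Polymatroid.
Variable n : nat.

Definition basis_vec (i : 'I_n) : 'rV[int]_n := delta_mx 0 i.

Definition polymatroid (P : {fset 'rV[int]_n}) : Prop :=
  P != fset0 /\
  forall a b, a \in P -> b \in P -> forall i : 'I_n, b 0 i < a 0 i ->
    exists j : 'I_n, [/\ a 0 j < b 0 j,
      a - basis_vec i + basis_vec j \in P &
      b + basis_vec i - basis_vec j \in P].

Definition has_level (P : {fset 'rV[int]_n}) (d : int) : Prop :=
  forall a, a \in P -> \sum_(i < n) a 0 i = d.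

Definition Int_act (P : {fset 'rV[int]_n}) (a : 'rV[int]_n) : {set 'I_n} :=
  [set i : 'I_n | ~~ [exists j : 'I_n,
     (j < i)%N && (a - basis_vec i + basis_vec j \in P)]].

Definition Ext_act (P : {fset 'rV[int]_n}) (a : 'rV[int]_n) : {set 'I_n} :=
  [set i : 'I_n | ~~ [exists j : 'I_n,
     (j < i)%N && (a + basis_vec i - basis_vec j \in P)]].

(* In {poly {poly int}}, x is 'X and y is 'Y := 'X%:P (polyXY), so that
   p.[u, v] evaluates p at x = u and y = v. *)
Definition polymatroid_tutte (P : {fset 'rV[int]_n}) : {poly {poly int}} :=
  \sum_(a <- P)
     'X ^+ #|Int_act P a :\: Ext_act P a| *
     'Y ^+ #|Ext_act P a :\: Int_act P a| *
     ('X + 'Y - 1) ^+ #|Int_act P a :&: Ext_act P a|.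

End Polymatroid.

Definition ratfun := {fraction {poly {poly int}}}.

Definition ratX : ratfun := tofrac 'X.
Definition ratY : ratfun := tofrac 'Y.

Definition eval_rat (p : {poly {poly int}}) (u v : ratfun) : ratfun :=
  (map_poly (map_poly (fun c : int => c%:~R : ratfun)) p).[u, v].

Definition T_rat (n : nat) (P : {fset 'rV[int]_n}) (d : int) : ratfun :=
  let w := ratX + ratY - ratX * ratY in
  w ^+ n / (ratX ^ (n%:Z - d) * ratY ^ d) *
  eval_rat (polymatroid_tutte P) (ratX / w) (ratY / w).

(* L (i, j) is the coefficient of x^i y^j. *)
Definition laurent := {fsfun int * int -> int with 0}.

Definition laurent_rat (L : laurent) : ratfun :=
  \sum_(k <- finsupp L) (L k)%:~R * ratX ^ k.1 * ratY ^ k.2.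

Definition is_min_ydeg (L : laurent) (l : int) : Prop :=
  (exists i : int, L (i, l) != 0) /\
  (forall i j : int, L (i, j) != 0 -> l <= j).

(* L(x, -1/y): the monomial x^i y^j becomes (-1)^j x^i y^(-j). *)
Definition subst_neg_inv (L : laurent) : laurent :=
  [fsfun k in [fset (m.1, - m.2) | m in finsupp L] =>
     (-1) ^ k.2 * L (k.1, - k.2) | 0].

(* A formal series in x and y is given by its coefficients, indexed by all
   pairs of integers. *)
Definition B_coef (i j : int) : int :=
  if (0 <= i) && (0 <= j) then ('C(`|i|%N, `|j|%N))%:Z else 0.

(* [x^p y^q] (S * L); the Cauchy product is a finite sum because L has
   finite support. *)
Definition coef_mul (S : int -> int -> int) (L : laurent) (p q : int) : int :=
  \sum_(k <- finsupp L) S (p - k.1) (q - k.2) * L k.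

(* Main.v *)
Require Import Defs.
From mathcomp Require Import all_boot all_order all_algebra.
From mathcomp Require Import finmap.
From mathcomp Require Import zify ring.
Import Order.TTheory GRing.Theory Num.Theory.
Local Open Scope ring_scope.

(** Write w = x + y - xy, and for a in P let c(a) be the number of indices that
    are neither internally nor externally active at a. Since
    x/w + y/w - 1 = xy/w, clearing denominators in the definition of T_P gives
      x^(n-d) y^d T_P = F := sum_a x^|Int a| y^|Ext a| w^c(a),
    a polynomial, so T_P is a Laurent polynomial.

    The substitution y := -1/y turns w into -(1 - x(1+y))/y, that is, into
    -1/(y B). So B times a multiple of w is a Laurent polynomial rather than an
    infinite series, and has no high powers of y; coefficientwise this is
    Pascal's rule ([pairing_omega], [B_coef_pascal]). Everything therefore rests
    on the congruence ([tutte_numerator_mod])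
      F = x^n y^n  modulo w,
    because the coefficients of B times the image of x^d y^(n-d) are, up to the
    sign (-1)^(n-d), single binomial coefficients, which vanish for p < n + q and
    are 1 at p = n + q.

    For the congruence, only the a with c(a) = 0 matter. Call a selected by a
    set S of indices if S is contained in Ext a and the complement of S in
    Int a. Every S selects exactly one a in P: it maximises
    sum_i (+-1) 2^i a_i with sign + on S and - off S ([selected_exists]), and
    two selected elements coincide by the Exchange Axiom applied at the largest
    index where they differ ([selected_inj]). Expanding (u + v)^n as a sum over
    S and grouping by the selected element gives ([passive0_sum])
      sum_(c(a)=0) v^|Int - Ext| u^|Ext - Int| (u + v)^|Int & Ext| = (u + v)^n.
    At u = y, v = x, and since x + y = xy modulo w, this is the congruence.

    Finally let e be the least |Ext a|. The minimal y-degree of T_P is e - d: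
    the substitution x := 1 sends w to 1 and F to sum_a y^|Ext a|, so the terms
    of lowest y-degree cannot cancel. The bound q >= d - e is what makes Pascal's
    rule available: the cofactor of w in F - x^n y^n has no terms of y-degree
    less than e ([omega_low_coef]), while Pascal's rule for B fails only in
    negative y-degree. *)

(** * Selection of an element of a polymatroid by a set of indices *)

Section Combinatorics.
Context {n : nat}.
Implicit Types (P : {fset 'rV[int]_n}) (a b : 'rV[int]_n) (S : {set 'I_n}).

Lemma Int_actPn P a (i : 'I_n) :
  reflect (exists2 j : 'I_n, (j < i)%N & a - basis_vec i + basis_vec j \in P)
          (i \notin Int_act P a).
Proof.
rewrite inE negbK; apply: (iffP existsP) => -[j].
  by case/andP=> ? ?; exists j.
by move=> ? ?; exists j; apply/andP.
Qed.

Lemma Ext_actPn P a (i : 'I_n) :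
  reflect (exists2 j : 'I_n, (j < i)%N & a + basis_vec i - basis_vec j \in P)
          (i \notin Ext_act P a).
Proof.
rewrite inE negbK; apply: (iffP existsP) => -[j].
  by case/andP=> ? ?; exists j.
by move=> ? ?; exists j; apply/andP.
Qed.

Definition selected P S a := (~: S \subset Int_act P a) && (S \subset Ext_act P a).

(** With weights +-2^i, a move that raises a_i for i in S, or lowers it for i
    outside S, at the expense of a smaller index j always gains at least
    2^i - 2^j > 0; so at a maximum of the weighted sum every i in S is
    externally active and every i outside S internally active. *)
Lemma selected_exists P S :
  P != fset0 -> exists2 a, a \in P & selected P S a.
Proof.
case/fset0Pn=> a0 a0P.
pose eps i : int := if i \in S then 1 else -1.
pose wt a : int := \sum_i eps i * 2 ^+ i * a 0 i.
have wtD a b : wt (a + b) = wt a + wt b.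
  by rewrite /wt -big_split; apply: eq_bigr => i _; rewrite mxE /=; ring.
have wtN a : wt (- a) = - wt a.
  by rewrite /wt -sumrN; apply: eq_bigr => i _; rewrite mxE /=; ring.
have wtb i : wt (basis_vec i) = eps i * 2 ^+ i.
  rewrite /wt (bigD1 i) //= mxE !eqxx mulr1 big1 ?addr0 // => j /negbTE nji.
  by rewrite mxE eqxx nji mulr0.
have pow2 (j i : nat) : (j < i)%N -> (2 : int) ^+ j < 2 ^+ i.
  by move=> ji; rewrite ltr_eXn2l.
have pos2 (j : nat) : (0 : int) < 2 ^+ j by rewrite exprn_gt0.
have [a _ amax] := Order.TotalTheory.arg_maxP (fun a : P => wt (val a)) (isT : xpredT [` a0P]%fset).
exists (val a); first exact: valP.
have wtmax b : b \in P -> wt b <= wt (val a) by move=> bP; apply: (amax [` bP]%fset).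
apply/andP; split; apply/subsetP=> i iS.
  rewrite in_setC in iS.
  apply/negPn/negP => /Int_actPn[j ji /wtmax].
  rewrite !wtD wtN !wtb {1}/eps (negbTE iS) /eps.
  by have := pow2 _ _ ji; have := pos2 j; case: ifP; lia.
apply/negPn/negP => /Ext_actPn[j ji /wtmax].
rewrite !wtD wtN !wtb {1}/eps iS /eps.
by have := pow2 _ _ ji; have := pos2 j; case: ifP; lia.
Qed.

(** At the largest index i where a and b differ, the Exchange Axiom moves a unit
    between i and some j, and j < i because a and b agree above i. For i in S
    this contradicts the external activity of i at the element with the smaller
    i-th entry; for i outside S, the internal activity at the other one. *)
Lemma selected_inj P S a b : polymatroid P -> a \in P -> b \in P ->
  selected P S a -> selected P S b -> a = b.
Proof.
case=> _ exch aP bP sa sb.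
have lt_sel (c e : 'rV[int]_n) (i : 'I_n) : c \in P -> e \in P -> selected P S c ->
    selected P S e -> (forall k : 'I_n, (i < k)%N -> c 0 k = e 0 k) -> ~ e 0 i < c 0 i.
  move=> cP eP /andP[/subsetP cI cE] /andP[eI /subsetP eE] agree lt_i.
  have [j [jlt cij eij]] := exch c e cP eP i lt_i.
  have ji : (j < i)%N.
    rewrite ltnNge leq_eqVlt; apply/negP => /orP[/eqP/val_inj eij'|/agree cej].
      by move: lt_i; rewrite eij' lt_gtF.
    by rewrite cej ltxx in jlt.
  case: (boolP (i \in S)) => iS.
    by have /negP[] : i \notin Ext_act P e; [apply/Ext_actPn; exists j|exact: eE].
  by have /negP[] : i \notin Int_act P c; [apply/Int_actPn; exists j|apply: cI; rewrite inE].
apply/rowP; case: (pickP (fun i => a 0 i != b 0 i)) => [i0 ab0|ab]; last first.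
  by move=> i; apply/eqP; rewrite -[_ == _]negbK ab.
have [i abi imax] := arg_maxnP (P := fun i => a 0 i != b 0 i) (fun i : 'I_n => val i) ab0.
have agree (k : 'I_n) : (i < k)%N -> a 0 k = b 0 k.
  by move=> ik; apply/eqP; apply: contraTT ik => /imax; rewrite -leqNgt.
case: (ltgtP (a 0 i) (b 0 i)) abi => // lt_i _.
  by case: (lt_sel b a i bP aP sb sa _ lt_i) => k /agree.
by case: (lt_sel a b i aP bP sa sb agree lt_i).
Qed.

Lemma sum_selected (R : pzSemiRingType) P S : polymatroid P ->
  \sum_(a <- P) (selected P S a)%:R = 1 :> R.
Proof.
move=> Ppm; have [a aP sa] := @selected_exists P S Ppm.1.
rewrite (big_fsetD1 a) //= sa big_seq big1 ?addr0 // => b.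
rewrite !inE => /andP[nba bP]; case: (boolP (selected P S b)) => // sb.
by rewrite (@selected_inj P S b a) ?eqxx in nba.
Qed.

Definition passive P a := #|~: (Int_act P a :|: Ext_act P a)|.

(** Each side is a sum over all sets S of u^|S| v^(n-|S|): on the right by
    expanding the product, on the left because a is selected exactly by the sets
    between the complement of Int a and Ext a. The factor 0 ^+ passive P a
    keeps only the a for which Int a and Ext a cover all the indices. *)
Lemma passive0_sum (R : comNzRingType) (u v : R) P : polymatroid P ->
  \sum_(a <- P) v ^+ #|Int_act P a :\: Ext_act P a| *
    u ^+ #|Ext_act P a :\: Int_act P a| *
    (u + v) ^+ #|Int_act P a :&: Ext_act P a| * 0 ^+ passive P a = (u + v) ^+ n.
Proof.
move=> Ppm.
have prodA (A : {set 'I_n}) (x : R) : x ^+ #|A| = \prod_i (if i \in A then x else 1).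
  by rewrite -big_mkcond prodr_const.
transitivity (\sum_(S : {set 'I_n}) (\prod_i (if i \in S then u else v)) *
                \sum_(a <- P) (selected P S a)%:R); last first.
  under eq_bigr => S _ do rewrite sum_selected // mulr1.
  by rewrite -(bigA_distr 1 +%R) prodr_const card_ord.
under [RHS]eq_bigr => S _ do rewrite big_distrr.
rewrite exchange_big; apply: eq_bigr => a _.
pose I := Int_act P a; pose E := Ext_act P a.
transitivity (\prod_i (u *+ (i \in E) + v *+ (i \in I))).
  rewrite /passive !prodA -!big_split; apply: eq_bigr => i _.
  rewrite /= in_setC in_setU in_setI !in_setD -/I -/E.
  by case: (i \in I); case: (i \in E); rewrite /= ?mulr1 ?mul1r ?addr0 ?add0r.
rewrite (bigA_distr 1 +%R); apply: eq_bigr => S _.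
(* If S does not select a, the product over S has a zero factor. *)
rewrite /selected.
case: (boolP (_ \subset _)) => SI; last first.
  case/subsetPn: SI => i; rewrite inE => /negbTE iS /negbTE iI.
  by rewrite /= mulr0 (bigD1 i) //= iS iI mul0r.
case: (boolP (_ \subset _)) => SE; last first.
  by case/subsetPn: SE => i iS /negbTE iE; rewrite /= mulr0 (bigD1 i) //= iS iE mul0r.
rewrite /= mulr1; apply: eq_bigr => i _; case: ifP => iS.
  by rewrite (subsetP SE).
by rewrite (subsetP SI) // inE iS.
Qed.

End Combinatorics.

(** * Linear functionals on bivariate polynomials *)

Section Pairing.
Context {V : zmodType}.
Implicit Types (f : nat -> nat -> V) (F G : {poly {poly int}}).

(** The linear map sending x^i y^j to f i j. It serves twice: with values in the
    field of fractions, to evaluate a Laurent polynomial, and with integer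
    values, to extract a coefficient of its product with B. *)
Definition pairing f F : V :=
  \sum_(i < size F) \sum_(j < sizeY F) f i j *~ F`_i`_j.

Lemma big_ord_extend (g : nat -> V) (m m' : nat) :
  (forall i, (m <= i)%N -> g i = 0) -> \sum_(i < m + m') g i = \sum_(i < m) g i.
Proof.
move=> g0; rewrite big_split_ord /= [X in _ + X]big1 ?addr0 // => i _.
by rewrite g0 // leq_addr.
Qed.

Lemma coefXY_lt F i j : F`_i`_j != 0 -> (i < size F)%N && (j < sizeY F)%N.
Proof.
move=> Fij; apply/andP; split; rewrite ltnNge; apply: contra Fij => le.
  by rewrite (nth_default 0 le) coef0.
by rewrite [F`_i`_j]nth_default // (leq_trans _ le) ?max_size_coefXY.
Qed.

Lemma pairing_widen f F (m r : nat) :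
  (forall i j, F`_i`_j != 0 -> (i < m)%N && (j < r)%N) ->
  pairing f F = \sum_(i < m) \sum_(j < r) f i j *~ F`_i`_j.
Proof.
suff gen (m1 m2 r1 r2 : nat) :
    (forall i j, F`_i`_j != 0 -> (i < m1)%N && (j < r1)%N) ->
    \sum_(i < m1) \sum_(j < r1) f i j *~ F`_i`_j =
    \sum_(i < m1 + m2) \sum_(j < r1 + r2) f i j *~ F`_i`_j.
  move=> Fmr; rewrite /pairing (gen _ m _ r) => [|i j]; last exact: coefXY_lt.
  by rewrite [RHS](gen _ (size F) _ (sizeY F)) // (addnC m) (addnC r).
move=> F0; have Z i j : ~~ ((i < m1)%N && (j < r1)%N) -> f i j *~ F`_i`_j = 0.
  by move=> N; case: (F`_i`_j =P 0) => [->|/eqP/F0 /(negP N)]; rewrite ?mulr0z.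
rewrite (big_ord_extend (fun i => \sum_(j < r1 + r2) f i j *~ F`_i`_j)) => [|i mi].
  apply: eq_bigr => i _; rewrite (big_ord_extend (fun j => f i j *~ F`_i`_j)) // => j rj.
  by rewrite Z // [(j < r1)%N]ltnNge rj andbF.
by rewrite big1 // => j _; rewrite Z // ltnNge mi.
Qed.

Lemma pairingD f F G : pairing f (F + G) = pairing f F + pairing f G.
Proof.
pose m := (size F + size G)%N; pose r := (sizeY F + sizeY G)%N.
have bF i j : F`_i`_j != 0 -> (i < m)%N && (j < r)%N.
  by move=> /coefXY_lt/andP[? ?]; rewrite !ltn_addr.
have bG i j : G`_i`_j != 0 -> (i < m)%N && (j < r)%N.
  by move=> /coefXY_lt/andP[? ?]; rewrite !ltn_addl.
rewrite !(@pairing_widen f _ m r) // => [|i j].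
  rewrite -big_split; apply: eq_bigr => i _; rewrite -big_split.
  by apply: eq_bigr => j _; rewrite !coefD mulrzDr.
rewrite !coefD; case: (F`_i`_j =P 0) => [->|/eqP/bF//].
by rewrite add0r => /bG.
Qed.

Lemma pairingN f F : pairing f (- F) = - pairing f F.
Proof. 
apply/eqP; rewrite -addr_eq0 -pairingD addNr /pairing size_poly0.
by rewrite big_ord0.
Qed.

Lemma pairing_mulX f F : pairing f ('X * F) = pairing (fun i => f i.+1) F.
Proof.
rewrite (@pairing_widen _ _ (size F).+1 (sizeY F)) => [|[|i] j].
- rewrite big_ord_recl /= big1 ?add0r => [|j _]; last by rewrite coefXM coef0 mulr0z.
  by apply: eq_bigr => i _; apply: eq_bigr => j _; rewrite coefXM.
- by rewrite coefXM coef0 eqxx.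
- by rewrite coefXM => /coefXY_lt.
Qed.

Lemma pairing_mulY f F : pairing f ('Y * F) = pairing (fun i j => f i j.+1) F.
Proof.
have cY i j : ('Y * F)`_i`_j = if j is j'.+1 then F`_i`_j' else 0.
  by rewrite coefCM coefXM; case: j.
rewrite (@pairing_widen _ _ (size F) (sizeY F).+1) => [|i [|j]]; rewrite ?cY.
- apply: eq_bigr => i _; rewrite big_ord_recl cY mulr0z add0r.
  by apply: eq_bigr => j _; rewrite cY.
- by rewrite eqxx.
- by move/coefXY_lt.
Qed.

Lemma pairing_monomial f (i j : nat) : pairing f ('X ^+ i * 'Y ^+ j) = f i j.
Proof.
have c1 k l : ('X^i * 'Y ^+ j : {poly {poly int}})`_k`_l = ((k == i) && (l == j))%:R.
  rewrite -rmorphXn /= coefMC coefXn; case: (k == i); last by rewrite mul0r coef0.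
  by rewrite mul1r coefXn.
rewrite (@pairing_widen _ _ i.+1 j.+1) => [|k l].
  rewrite (bigD1 ord_max) //= [X in _ + X]big1 => [|k /eqP/val_eqP/= /negbTE ki]; last first.
    by apply: big1 => l _; rewrite c1 ki.
  rewrite addr0 (bigD1 ord_max) //= [X in _ + X]big1 => [|l /eqP/val_eqP/= /negbTE lj]; last first.
    by rewrite c1 lj andbF.
  by rewrite c1 !eqxx addr0.
by rewrite c1; case: (k =P i) => [->|]; case: (l =P j) => [->|] //=; rewrite !ltnSn.
Qed.

End Pairing.

Definition omega : {poly {poly int}} := 'X + 'Y - 'X * 'Y.

(** The hypothesis says that the functional kills x^i y^j omega; it is
    required only for the monomials that occur in Q. *)
Lemma pairing_omega {V : zmodType} (f : nat -> nat -> V) (Q : {poly {poly int}}) :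
  (forall i j, Q`_i`_j != 0 -> f i.+1 j + f i j.+1 = f i.+1 j.+1) ->
  pairing f (omega * Q) = 0.
Proof.
move=> fQ.
have -> : omega * Q = 'X * Q + 'Y * Q + - ('X * ('Y * Q)) by rewrite /omega; ring.
rewrite !pairingD pairingN !pairing_mulX !pairing_mulY /pairing.
apply/eqP; rewrite subr_eq0 -big_split; apply/eqP; apply: eq_bigr => i _.
rewrite -big_split; apply: eq_bigr => j _ /=; rewrite -mulrzDl.
by case: (Q`_i`_j =P 0) => [->|/eqP/fQ ->]; rewrite ?mulr0z.
Qed.

(** The coefficient of x^(i+1) y^j in omega Q is the coefficient of x^i y^j in Q
    plus coefficients of Q of y-degree j - 1, so that induction on j applies. *)
Lemma omega_low_coef (Q : {poly {poly int}}) (e : nat) :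
  (forall i j, (j < e)%N -> (omega * Q)`_i`_j = 0) ->
  forall i j, (j < e)%N -> Q`_i`_j = 0.
Proof.
move=> wQ0 i j; elim: j i => [|j IH] i je.
  have := wQ0 i.+1 0%N je.
  by rewrite /omega mulrBl mulrDl -mulrA !(coefB, coefD) !coefXM !coefCM !coefXM addr0 subr0.
have := wQ0 i.+1 j.+1 je.
rewrite /omega mulrBl mulrDl -mulrA !(coefB, coefD) !coefXM !coefCM !coefXM /=.
by rewrite !IH ?(ltnW je) // addr0 subr0.
Qed.

(** * Laurent polynomials as shifted polynomials *)

Section LaurentOf.
Variables (F : {poly {poly int}}) (s t : int).

Let pos (u : 'I_(size F) * 'I_(sizeY F)) : int * int :=
  ((u.1 : nat)%:Z - s, (u.2 : nat)%:Z - t).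

(** The Laurent polynomial F / (x^s y^t). *)
Definition laurent_of : laurent :=
  [fsfun k in [fset pos u | u : 'I_(size F) * 'I_(sizeY F)]%fset =>
     F`_(absz (k.1 + s))`_(absz (k.2 + t)) | 0].

Lemma laurent_ofE (i j : nat) : laurent_of (i%:Z - s, j%:Z - t) = F`_i`_j.
Proof.
rewrite fsfunE /= !subrK !absz_nat; case: ifP => // /negP nin.
apply/eqP; rewrite eq_sym; apply/negPn/negP => /coefXY_lt/andP[iF jF]; apply: nin.
by apply/imfsetP; exists (Ordinal iF, Ordinal jF).
Qed.

Lemma laurent_of_supp k : laurent_of k != 0 ->
  exists i j : nat, k = (i%:Z - s, j%:Z - t).
Proof.
rewrite fsfunE; case: ifP => [/imfsetP[u _ ->] _|]; last by rewrite eqxx.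
by exists u.1, u.2.
Qed.

Lemma sum_laurent_of (V : zmodType) (g : int -> int -> V) :
  \sum_(k <- finsupp laurent_of) g k.1 k.2 *~ laurent_of k =
  pairing (fun i j => g (i%:Z - s) (j%:Z - t)) F.
Proof.
rewrite (big_fset_incl _ (finsupp_sub _ _ _)) => [|k _]; last first.
  by rewrite memNfinsupp => /eqP ->; rewrite mulr0z.
rewrite big_imfset /= => [|[i j] [i' j'] _ _ [/addIr[ii'] /addIr[jj']]]; last first.
  by congr pair; apply: val_inj.
rewrite /pairing pair_big big_enum /=; apply: eq_bigr => -[i j] _ /=.
by rewrite laurent_ofE.
Qed.

End LaurentOf.

Lemma ratX_neq0 : ratX != 0.
Proof. by rewrite tofrac_eq0 polyX_eq0. Qed.

Lemma ratY_neq0 : ratY != 0.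
Proof. by rewrite tofrac_eq0 polyC_eq0 polyX_eq0. Qed.

Lemma pairing_tofrac F : pairing (fun i j => ratX ^+ i * ratY ^+ j) F = tofrac F.
Proof.
have rowE i : F`_i = \sum_(j < sizeY F) F`_i`_j *: 'X^j.
  rewrite -poly_def; apply/polyP => j; rewrite coef_poly; case: ltnP => // le.
  by rewrite nth_default // (leq_trans (max_size_coefXY F i)).
transitivity (tofrac (\sum_(i < size F) F`_i *: 'X^i)); last by rewrite -poly_def coefK.
rewrite rmorph_sum; apply: eq_bigr => i _.
rewrite -mul_polyC [in RHS]rowE rmorph_sum mulr_suml rmorph_sum; apply: eq_bigr => j _ /=.
rewrite -[in RHS](intz F`_i`_j) scaler_int !rmorphMz rmorphM /= rmorphMz !rmorphXn /=.
by rewrite mulrzAl mulrC.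
Qed.

(** Stated over an arbitrary field: in the concrete field of fractions, the
    normalisation of such an identity would unfold the quotient construction. *)
Lemma monomial_shift (K : fieldType) (x y : K) (i j : nat) (s t : int) :
  x != 0 -> y != 0 ->
  x ^ (i%:Z - s) * y ^ (j%:Z - t) = x ^+ i * y ^+ j / (x ^ s * y ^ t).
Proof.
by move=> x0 y0; rewrite !expfzDr // -!exprnP -!invr_expz invfM; ring.
Qed.

Lemma pairing_mulr (K : pzRingType) (f : nat -> nat -> K) (c : K) F :
  pairing (fun i j => f i j * c) F = pairing f F * c.
Proof.
rewrite /pairing mulr_suml; apply: eq_bigr => i _; rewrite mulr_suml.
by apply: eq_bigr => j _; rewrite mulrzAl.
Qed.

Lemma eq_pairing (V : zmodType) (f g : nat -> nat -> V) F :
  (forall i j, f i j = g i j) -> pairing f F = pairing g F.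
Proof. by move=> fg; apply: eq_bigr => i _; apply: eq_bigr => j _; rewrite fg. Qed.

Lemma laurent_rat_of F s t :
  laurent_rat (laurent_of F s t) = tofrac F / (ratX ^ s * ratY ^ t).
Proof.
have -> : laurent_rat (laurent_of F s t) =
    \sum_(k <- finsupp (laurent_of F s t)) (ratX ^ k.1 * ratY ^ k.2) *~ laurent_of F s t k.
  by apply: eq_bigr => k _; rewrite -mulrA mulrzl.
rewrite (sum_laurent_of F s t _ (fun i j => ratX ^ i * ratY ^ j)).
rewrite -pairing_tofrac -pairing_mulr; apply: eq_pairing => i j.
by apply: monomial_shift; [exact: ratX_neq0|exact: ratY_neq0].
Qed.

(** One exponent M must work for two Laurent polynomials at once in
    [laurent_rat_inj], hence the statement for all large M. *)
Lemma laurent_of_surj (L : laurent) : exists M0 : nat, forall M : nat,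
  (M0 <= M)%N -> exists F, L = laurent_of F M M.
Proof.
pose M0 := (\sum_(k <- finsupp L) (absz k.1 + absz k.2))%N.
exists M0 => M leM.
have inM k : L k != 0 -> (absz k.1 <= M)%N && (absz k.2 <= M)%N.
  rewrite -(mem_finsupp L) => kL.
  have : (absz k.1 + absz k.2 <= M0)%N by rewrite /M0 (big_fsetD1 k) //= leq_addr.
  by move=> le; rewrite !(leq_trans _ leM) // (leq_trans _ le) ?leq_addr ?leq_addl.
pose F : {poly {poly int}} :=
  \poly_(i < M.*2.+1) \poly_(j < M.*2.+1) L (i%:Z - M%:Z, j%:Z - M%:Z).
have FE (i j : nat) : F`_i`_j = L (i%:Z - M%:Z, j%:Z - M%:Z).
  have [L0|/inM/= bnd] := eqVneq (L (i%:Z - M%:Z, j%:Z - M%:Z)) 0.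
    by rewrite L0 /F coef_poly; case: ifP; rewrite ?coef0 // coef_poly L0 if_same.
  by rewrite /F coef_poly ifT ?coef_poly ?ifT //; lia.
exists F; apply/fsfunP => k; apply/eqP.
case: (boolP ((0 <= k.1 + M%:Z) && (0 <= k.2 + M%:Z))) => [kM|kM].
  have -> : k = ((absz (k.1 + M%:Z))%:Z - M%:Z, (absz (k.2 + M%:Z))%:Z - M%:Z).
    by case: k kM => k1 k2 /= kM; congr (_, _); lia.
  by rewrite laurent_ofE FE.
case: (L k =P 0) => [->|/eqP/inM]; last by move: kM; lia.
case: (laurent_of F M M k =P 0) => [->//|/eqP/laurent_of_supp[i [j kE]]].
by move: kM; rewrite kE /=; lia.
Qed.

(** Over a common denominator, two Laurent polynomials become polynomials, and
    the ring of polynomials embeds in its field of fractions. *)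
Lemma laurent_rat_inj : injective laurent_rat.
Proof.
move=> L L'; have [M1 HM1] := laurent_of_surj L; have [M2 HM2] := laurent_of_surj L'.
have [F ->] := HM1 _ (leq_addr M2 M1); have [F' ->] := HM2 _ (leq_addl M1 M2).
rewrite !laurent_rat_of; set c := _^-1.
have c0 : c != 0.
  apply: invr_neq0; apply: mulf_neq0; first exact: expfz_neq0 ratX_neq0.
  exact: expfz_neq0 ratY_neq0.
move=> /(mulIf c0) FF'; congr laurent_of; apply/eqP.
by rewrite -tofrac_eq; apply/eqP.
Qed.

Lemma coef_mul_subst_neg_inv (L : laurent) (S : int -> int -> int) (p q : int) :
  coef_mul S (subst_neg_inv L) p q =
  \sum_(k <- finsupp L) (S (p - k.1) (q + k.2) * (-1) ^ (- k.2)) *~ L k.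
Proof.
rewrite /coef_mul (big_fset_incl _ (finsupp_sub _ _ _)) => [|k _]; last first.
  by rewrite memNfinsupp => /eqP ->; rewrite mulr0.
rewrite big_imfset /= => [|[i j] [i' j'] _ _ [-> /oppr_inj ->]] //.
rewrite big_seq [RHS]big_seq; apply: eq_bigr => k kL.
rewrite fsfunE ifT; last by apply/imfsetP; exists k.
by rewrite /= !opprK -surjective_pairing mulrA -mulrzr intz.
Qed.

(** * The numerator of the Tutte polynomial *)

(** This is x^(n-d) y^d T_P. *)
Definition tutte_numerator {n : nat} (P : {fset 'rV[int]_n}) : {poly {poly int}} :=
  \sum_(a <- P) 'X ^+ #|Int_act P a| * 'Y ^+ #|Ext_act P a| * omega ^+ passive P a.

Lemma card_activity {n} (P : {fset 'rV[int]_n}) a :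
  [/\ #|Int_act P a| = (#|Int_act P a :\: Ext_act P a| + #|Int_act P a :&: Ext_act P a|)%N,
      #|Ext_act P a| = (#|Ext_act P a :\: Int_act P a| + #|Int_act P a :&: Ext_act P a|)%N &
      n = (#|Int_act P a :\: Ext_act P a| + #|Ext_act P a :\: Int_act P a| +
           #|Int_act P a :&: Ext_act P a| + passive P a)%N].
Proof.
set I := Int_act P a; set E := Ext_act P a.
have cI : #|I| = (#|I :\: E| + #|I :&: E|)%N by rewrite addnC cardsID.
have cE : #|E| = (#|E :\: I| + #|I :&: E|)%N by rewrite addnC setIC cardsID.
split=> //; have := cardsC (I :|: E); rewrite card_ord /passive -/I -/E => {1}<-.
by rewrite cardsU cI cE; lia.
Qed.

Lemma clear_denominator (K : fieldType) (x y w : K) (i e k c : nat) : w != 0 ->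
  w ^+ (i + e + k + c) * ((x / w) ^+ i * (y / w) ^+ e * (x * y / w) ^+ k) =
  x ^+ (i + k) * y ^+ (e + k) * w ^+ c.
Proof.
move=> w0; rewrite !exprMn !exprD !exprVn.
move: (expf_neq0 i w0) (expf_neq0 e w0) (expf_neq0 k w0).
move: (w ^+ i) (w ^+ e) (w ^+ k) => wi we wk wi0 we0 wk0.
by field; rewrite wi0 we0 wk0.
Qed.

(** The third factor of each term of the Tutte polynomial becomes a power of
    x/w + y/w - 1 = xy/w, so w^n is a common denominator and leaves the exponent
    n - |Int & Ext| - |Int - Ext| - |Ext - Int| = passive P a. *)
Lemma tutte_eval (K : fieldType) (x y : K) {n} (P : {fset 'rV[int]_n}) :
  let w := x + y - x * y in w != 0 ->
  w ^+ n * (map_poly (map_poly (fun c : int => c%:~R : K)) (polymatroid_tutte P)).[x / w, y / w] =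
  \sum_(a <- P) x ^+ #|Int_act P a| * y ^+ #|Ext_act P a| * w ^+ passive P a.
Proof.
move=> w w0.
pose ev : {rmorphism {poly {poly int}} -> K} :=
  horner_eval (y / w) \o (horner_eval (x / w)%:P \o map_poly (map_poly intr)).
rewrite -[_.[_, _]]/(ev (polymatroid_tutte P)) /polymatroid_tutte.
rewrite rmorph_sum mulr_sumr; apply: eq_bigr => a _.
have evX : ev 'X = x / w by rewrite /ev /= map_polyX /horner_eval hornerX hornerC.
have evY : ev 'Y = y / w.
  by rewrite /ev /= map_polyC /= map_polyX /horner_eval hornerC hornerX.
rewrite !rmorphM !rmorphXn rmorphB rmorphD rmorph1 evX evY.
have -> : x / w + y / w - 1 = x * y / w.
  by rewrite -mulrDl -[1](divff w0) -mulrBl /w; congr (_ / _); ring.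
have [-> -> /(congr1 (GRing.exp w)) ->] := card_activity P a.
exact: clear_denominator.
Qed.

Section Numerator.
Context {n : nat} (P : {fset 'rV[int]_n}).

Lemma T_rat_laurent (d : int) :
  T_rat P d = laurent_rat (laurent_of (tutte_numerator P) (n%:Z - d) d).
Proof.
have wE : ratX + ratY - ratX * ratY = tofrac omega.
  by rewrite rmorphB rmorphD rmorphM.
have w0 : ratX + ratY - ratX * ratY != 0.
  (* The value of omega at x = 1 is 1. *)
  rewrite wE tofrac_eq0; apply/eqP => /(congr1 (horner_eval 1)) /eqP.
  rewrite /horner_eval /omega !(hornerD, hornerN, hornerM) hornerX hornerC horner0.
  by rewrite mul1r addrK oner_eq0.
rewrite laurent_rat_of /T_rat mulrAC /eval_rat (tutte_eval _ _ _ _ w0).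
congr (_ / _); rewrite /tutte_numerator rmorph_sum; apply: eq_bigr => a _.
by rewrite wE !rmorphM !rmorphXn.
Qed.

Let eqw (F G : {poly {poly int}}) := exists Q, F = G + omega * Q.

Lemma eqw_exp (k : nat) : eqw ('X ^+ k * 'Y ^+ k) (('X + 'Y) ^+ k).
Proof.
rewrite -exprMn; exists (- \sum_(i < k) ('X * 'Y) ^+ (k.-1 - i) * ('X + 'Y) ^+ i).
apply/eqP; rewrite addrC -subr_eq subrXX /omega; apply/eqP; ring.
Qed.

(** A term with passive P a > 0 is a multiple of omega; in the other terms,
    x^k y^k may be replaced by (x + y)^k with k = |Int & Ext|, and
    [passive0_sum] with u = y and v = x applies. *)
Lemma tutte_numerator_mod : polymatroid P ->
  exists Q, tutte_numerator P = 'X ^+ n * 'Y ^+ n + omega * Q.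
Proof.
move=> Ppm; suff [Q ->] : eqw (tutte_numerator P) (('X + 'Y) ^+ n).
  by have [Q' ->] := eqw_exp n; exists (Q - Q'); ring.
rewrite addrC -(@passive0_sum n _ 'Y 'X P Ppm) /tutte_numerator.
elim/big_ind2: _ => [|F F' G G' [Q ->] [Q' ->]|a _]; first by exists 0; ring.
  by exists (Q + Q'); ring.
have [-> -> _] := card_activity P a.
case: (passive P a) => [|c]; last first.
  rewrite [0 ^+ _]exprS mul0r mulr0 exprS.
  by eexists; rewrite add0r [in LHS]mulrCA.
have [Q] := eqw_exp #|Int_act P a :&: Ext_act P a|.
rewrite !exprD !expr0 [in 'Y + 'X]addrC.
move: ('X ^+ _) ('Y ^+ _) ('X ^+ _) ('Y ^+ _) (('X + 'Y) ^+ _) => x1 y1 x2 y2 z E.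
by exists (x1 * y1 * Q); rewrite !mulr1 mulrACA E; ring.
Qed.

Lemma tutte_numerator_low (e : nat) :
  (forall a, a \in P -> (e <= #|Ext_act P a|)%N) ->
  forall i j, (j < e)%N -> (tutte_numerator P)`_i`_j = 0.
Proof.
move=> eP i j je; rewrite /tutte_numerator !coef_sum big_seq big1 // => a /eP ea.
by rewrite mulrAC -rmorphXn coefMC coefMXn (leq_trans je ea).
Qed.

(** At x = 1 the numerator becomes the sum of the y^|Ext b|, whose coefficient at
    y^|Ext a| counts the b with |Ext b| = |Ext a|. *)
Lemma tutte_numerator_min a : a \in P ->
  exists i, (tutte_numerator P)`_i`_#|Ext_act P a| != 0.
Proof.
move=> aP; set e := #|_|; set F := tutte_numerator P.
suff F1 : F.[1]`_e != 0.
  case: (boolP [exists i : 'I_(size F), F`_i`_e != 0]) => [/existsP[i Fi]|]; first by exists i.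
  rewrite negb_exists => /forallP F0; case/negP: F1.
  rewrite horner_coef coef_sum big1 // => i _.
  by rewrite expr1n mulr1; apply/eqP; rewrite -[_ == _]negbK.
have -> : F.[1] = \sum_(b <- P) 'X ^+ #|Ext_act P b|.
  rewrite horner_sum; apply: eq_bigr => b _.
  by rewrite /omega !hornerE addrK !expr1n mul1r mulr1.
rewrite coef_sum (big_fsetD1 a) //= coefXn eqxx gt_eqF // ltr_wpDr ?ltr01 //.
by apply: sumr_ge0 => b _; rewrite coefXn ler0n.
Qed.

End Numerator.

(** * Coefficients of the product with B *)

(** For b = -1 the rule fails: B_coef 0 0 = 1, while both terms on the right
    are 0 when a = 0. *)
Lemma B_coef_pascal (a b : int) : 0 <= b ->
  B_coef a (b + 1) = B_coef (a - 1) b + B_coef (a - 1) (b + 1).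
Proof.
case: b => // b _; rewrite -PoszD addn1 /B_coef.
case: a => [[|a]|a] //.
have -> : a.+1%:Z - 1 = a%:Z by lia.
by rewrite /= binS PoszD addrC.
Qed.

Lemma signz_succ (z : int) : (-1) ^ (- z) = - (-1) ^ (- (z + 1)) :> int.
Proof.
by rewrite opprD exprzDr ?unitrN1 // exprN1 invrN1 mulrN1 opprK.
Qed.

(** Only x^n y^n contributes to the coefficient, since the functional kills the
    multiple omega Q of omega: the y-degrees j of Q are at least e, so that
    q + (j - d) >= 0 and Pascal's rule applies. *)
Lemma coef_mul_tutte n (P : {fset 'rV[int]_n}) (d p q : int) (e : nat) :
  polymatroid P -> (forall a, a \in P -> (e <= #|Ext_act P a|)%N) ->
  (e <= n)%N -> d - e%:Z <= q ->
  coef_mul B_coef (subst_neg_inv (laurent_of (tutte_numerator P) (n%:Z - d) d)) p q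
  = B_coef (p - d) (q + (n%:Z - d)) * (-1) ^ (n%:Z - d).
Proof.
move=> Ppm eP en qe; rewrite coef_mul_subst_neg_inv.
pose g i j := B_coef (p - i) (q + j) * (-1) ^ (- j) : int.
rewrite (sum_laurent_of _ _ _ _ g).
have [Q FQ] := tutte_numerator_mod P Ppm.
rewrite FQ pairingD pairing_monomial pairing_omega ?addr0 /g.
  congr (B_coef _ _ * _); first by lia.
  by rewrite -exprz_inv invrN1.
move=> i j Qij.
have ej : (e <= j)%N.
  rewrite leqNgt; apply: contra Qij => je; apply/eqP; apply: (omega_low_coef Q e) (je).
  move=> k l le; have := tutte_numerator_low P e eP k l le.
  rewrite FQ !coefD -rmorphXn coefMC coefXn; case: (k == n); rewrite ?mul0r ?coef0 ?add0r //.
  by rewrite mul1r coefXn [l == n]ltn_eqF ?add0r // (leq_trans le).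
have := B_coef_pascal (p - (i%:Z - (n%:Z - d))) (q + (j%:Z - d)).
rewrite (signz_succ (j%:Z - d)).
have -> : j.+1%:Z - d = j%:Z - d + 1 by lia.
have -> : p - (i.+1%:Z - (n%:Z - d)) = p - (i%:Z - (n%:Z - d)) - 1 by lia.
rewrite !addrA => -> //; last lia.
by ring.
Qed.

Theorem proposition5p4 (n : nat) (n_gt0 : (0 < n)%N)
    (P : {fset 'rV[int]_n}) (d : int)
    (P_polymatroid : polymatroid P) (P_level : has_level P d) :
  (exists L : laurent, laurent_rat L = T_rat P d) /\
  (forall L : laurent, laurent_rat L = T_rat P d ->
     exists l : int, is_min_ydeg L l /\
       forall q : int, - l <= q ->
         (forall p : int, p < n%:Z + q ->
            coef_mul B_coef (subst_neg_inv L) p q = 0) /\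
         coef_mul B_coef (subst_neg_inv L) (n%:Z + q) q = (-1) ^ (n%:Z - d)).
Proof.
rewrite T_rat_laurent; split=> [|L /laurent_rat_inj ->]; first by eexists.
have [a0 a0P] := fset0Pn _ P_polymatroid.1.
have [a _ amin] := @arg_minnP P [` a0P]%fset xpredT
  (fun a : P => #|Ext_act P (val a)|) isT.
have eP b : b \in P -> (#|Ext_act P (val a)| <= #|Ext_act P b|)%N.
  by move=> bP; apply: (amin [` bP]%fset).
have en : (#|Ext_act P (val a)| <= n)%N by rewrite -[leqRHS]card_ord max_card.
have [i Fi] := tutte_numerator_min P (val a) (valP a).
set e := #|_| in eP en Fi.
exists (e%:Z - d); split; first split.
- by exists (i%:Z - (n%:Z - d)); rewrite laurent_ofE.
- move=> i' j' /[dup] /laurent_of_supp[i1 [j1 [-> ->]]]; rewrite laurent_ofE => nz.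
  rewrite lerD2r lez_nat leqNgt; apply: contra nz => je.
  by rewrite (tutte_numerator_low P e eP).
move=> q qe.
have B0 p : coef_mul B_coef (subst_neg_inv (laurent_of (tutte_numerator P) (n%:Z - d) d)) p q
  = B_coef (p - d) (q + (n%:Z - d)) * (-1) ^ (n%:Z - d).
  by apply: (coef_mul_tutte n P d p q e) => //; lia.
split=> [p pq|]; rewrite B0 /B_coef.
  by case: ifP => [nn|]; rewrite ?mul0r // bin_small ?mul0r //; lia.
have -> : q + (n%:Z - d) = n%:Z + q - d by lia.
by rewrite ifT ?binn ?mul1r //; lia.
Qed.
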